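(* Let $q$ be not a root of unity. The representations $Q^{1,\pm}_1$, $Q^{2,\pm}_1$, $Q^{1,\pm}_{\sqrt q}$ and $Q^{2,\pm}_{\sqrt q}$ of $U_q(\mathrm{so}_3)$ are irreducible and pairwise nonequivalent. For any admissible value of $\lambda$, the representation $Q^+_\lambda$ (as well as the representation $Q^-_\lambda$) is not equivalent to any of these representations.
   Context: $q\in\mathbf C$, $q\ne0$; a logarithm of $q$ is fixed so that $q^x$ is defined for $x\in\mathbf C$; $\sqrt q=q^{1/2}$. $U_q(\mathrm{so}_3)$ is the unital associative complex algebra generated by $I_1,I_2,I_3$ with defining relations $q^{1/2}I_1I_2-q^{-1/2}I_2I_1=I_3$, $q^{1/2}I_2I_3-q^{-1/2}I_3I_2=I_1$, $q^{1/2}I_3I_1-q^{-1/2}I_1I_3=I_2$. A representation is determined by the operators of $I_1$ and $I_2$ (the operator of $I_3$ is given by the first relation). Let $\mathcal H$ be the complex vector space with basis $|m\rangle$, $m\in\mathbf Z$, and let $\lambda=q^\tau$ with $0\le\mathrm{Re}\,\tau<1$ (these are the admissible $\lambda$). The representations $Q^\pm_\lambda$ on $\mathcal H$ are given by $$Q^\pm_\lambda(I_1)|m\rangle=\pm\frac{\lambda q^m+\lambda^{-1}q^{-m}}{q-q^{-1}}|m\rangle,\qquad Q^\pm_\lambda(I_2)|m\rangle=\frac{1}{q-q^{-1}}|m+1\rangle+\frac1{q-q^{-1}}|m-1\rangle .$$ For $\lambda=1$, let $V_1=\mathrm{span}\{|0\rangle,\ |m\rangle+|-m\rangle: m\ge1\}$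 and $V_2=\mathrm{span}\{|m\rangle-|-m\rangle:m\ge1\}$; these are invariant under $Q_1^\pm$, and $Q_1^{1,\pm}$, $Q_1^{2,\pm}$ denote the subrepresentations of $Q_1^\pm$ on $V_1$, $V_2$ respectively. For $\lambda=\sqrt q$, let $W_1=\mathrm{span}\{|m\rangle-|-m-1\rangle:m\ge0\}$ and $W_2=\mathrm{span}\{|m\rangle+|-m-1\rangle:m\ge0\}$; these are invariant under $Q^\pm_{\sqrt q}$, and $Q^{1,\pm}_{\sqrt q}$, $Q^{2,\pm}_{\sqrt q}$ denote the subrepresentations of $Q^\pm_{\sqrt q}$ on $W_1$, $W_2$ respectively. *)

(* Defs.v *)
(* The complex numbers are R[i] for an arbitrary R : realType. *)
From HB Require Import structures.
From mathcomp Require Import all_boot all_order all_algebra.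
From mathcomp Require Import generic_quotient.
From mathcomp Require Import boolp reals sequences exp trigo.
From mathcomp Require Import complex freeg.
From mathcomp Require Import ring zify.

Set Implicit Arguments.
Unset Strict Implicit.
Unset Printing Implicit Defensive.

Import Order.TTheory GRing.Theory Num.Theory.
Local Open Scope ring_scope.
Local Open Scope complex_scope.
Local Open Scope quotient_scope.

Section ComplexPowers.
Variable R : realType.

Definition cexp (z : R[i]) : R[i] :=
  let: x +i* y := z in (expR x * cos y) +i* (expR x * sin y).

(* The power q ^ x determined by the chosen logarithm lnq of q. *)
Definition qpow (lnq x : R[i]) : R[i] := cexp (x * lnq).

Lemma cexpD z w : cexp (z + w) = cexp z * cexp w.
Proof.
case: z w => [a b] [c d].
rewrite /cexp; apply/eqP; rewrite eq_complex /=.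
by rewrite expRD cosD sinD; apply/andP; split; apply/eqP; ring.
Qed.

Lemma cexp0 : cexp 0 = 1.
Proof. by rewrite /cexp /= expR0 cos0 sin0 mulr1 mulr0. Qed.

Lemma cexp_neq0 z : cexp z != 0.
Proof.
apply/eqP => z0; have := cexpD z (- z).
by rewrite subrr cexp0 z0 mul0r; apply/eqP; rewrite oner_eq0.
Qed.

Lemma qpowD lnq x y : qpow lnq (x + y) = qpow lnq x * qpow lnq y.
Proof. by rewrite /qpow mulrDl cexpD. Qed.

Lemma qpow_neq0 lnq x : qpow lnq x != 0.
Proof. exact: cexp_neq0. Qed.

Lemma qpowN lnq x : qpow lnq (- x) = (qpow lnq x)^-1.
Proof.
apply: (mulIf (qpow_neq0 lnq x)); rewrite mulVf ?qpow_neq0 //.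
by rewrite -qpowD addNr /qpow mul0r cexp0.
Qed.

Lemma qpow1 lnq : qpow lnq 1 = qpow lnq (1 / 2) ^+ 2.
Proof. by rewrite expr2 -qpowD; congr (qpow _ _); field. Qed.

End ComplexPowers.

(* The algebra U_q(so_3): noncommutative polynomial expressions in I_1, I_2,
   I_3, modulo the least congruence containing the laws of a unital associative
   algebra and the three defining relations. *)
Section Algebra.
Variables (R : realType) (lnq : R[i]).
Local Notation C := R[i].

Inductive uterm : Type :=
  | TI1 | TI2 | TI3
  | TConst of C
  | TAdd of uterm & uterm
  | TMul of uterm & uterm.

Declare Scope uterm_scope.
Delimit Scope uterm_scope with ut.
Local Notation "x + y" := (TAdd x y) : uterm_scope.
Local Notation "x * y" := (TMul x y) : uterm_scope.
Local Notation "c %:T" := (TConst c) : uterm_scope.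

Inductive ueq : uterm -> uterm -> Prop :=
  | ueq_refl x : ueq x x
  | ueq_sym x y : ueq x y -> ueq y x
  | ueq_trans y x z : ueq x y -> ueq y z -> ueq x z
  | ueq_add x x' y y' : ueq x x' -> ueq y y' -> ueq (x + y)%ut (x' + y')%ut
  | ueq_mul x x' y y' : ueq x x' -> ueq y y' -> ueq (x * y)%ut (x' * y')%ut
  | ueq_addA x y z : ueq (x + (y + z))%ut ((x + y) + z)%ut
  | ueq_addC x y : ueq (x + y)%ut (y + x)%ut
  | ueq_add0 x : ueq (0%:T + x)%ut x
  | ueq_addN x : ueq ((- 1)%:T * x + x)%ut (0%:T)%ut
  | ueq_mulA x y z : ueq (x * (y * z))%ut ((x * y) * z)%ut
  | ueq_mul1 x : ueq (1%:T * x)%ut x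
  | ueq_mulDl x y z : ueq ((x + y) * z)%ut (x * z + y * z)%ut
  | ueq_mulDr x y z : ueq (x * (y + z))%ut (x * y + x * z)%ut
  | ueq_constD a b : ueq (TConst (a + b)) (a%:T + b%:T)%ut
  | ueq_constM a b : ueq (TConst (a * b)) (a%:T * b%:T)%ut
  | ueq_constC a x : ueq (a%:T * x)%ut (x * a%:T)%ut
  | ueq_rel12 : ueq ((qpow lnq (1 / 2))%:T * (TI1 * TI2)
                     + (- qpow lnq (- (1 / 2)))%:T * (TI2 * TI1))%ut TI3
  | ueq_rel23 : ueq ((qpow lnq (1 / 2))%:T * (TI2 * TI3)
                     + (- qpow lnq (- (1 / 2)))%:T * (TI3 * TI2))%ut TI1
  | ueq_rel31 : ueq ((qpow lnq (1 / 2))%:T * (TI3 * TI1)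
                     + (- qpow lnq (- (1 / 2)))%:T * (TI1 * TI3))%ut TI2.

HB.instance Definition _ := gen_eqMixin uterm.
HB.instance Definition _ := gen_choiceMixin uterm.

Definition ueqb (x y : uterm) : bool := `[< ueq x y >].

Lemma ueqb_refl : reflexive ueqb.
Proof. by move=> x; apply/asboolP; apply: ueq_refl. Qed.
Lemma ueqb_sym : symmetric ueqb.
Proof. by move=> x y; apply/asboolP/asboolP; apply: ueq_sym. Qed.
Lemma ueqb_trans : transitive ueqb.
Proof.
by move=> y x z /asboolP xy /asboolP yz; apply/asboolP; apply: ueq_trans xy yz.
Qed.

Canonical ueqb_equiv := EquivRel ueqb ueqb_refl ueqb_sym ueqb_trans.

Definition Uqso3 := {eq_quot ueqb}.
HB.instance Definition _ := Choice.on Uqso3.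
HB.instance Definition _ := EqQuotient.on Uqso3.

Definition ucls (x : uterm) : Uqso3 := \pi_Uqso3 x.

Lemma uclsP x y : ucls x = ucls y <-> ueq x y.
Proof. by split => [/eqmodP/asboolP //|xy]; apply/eqmodP/asboolP. Qed.

Lemma urepr (x : Uqso3) : ucls (repr x) = x.
Proof. exact: reprK. Qed.

Lemma uind (P : Uqso3 -> Prop) : (forall t, P (ucls t)) -> forall x, P x.
Proof. by move=> Pt x; rewrite -(urepr x). Qed.

Lemma ucls_repr x : ueq (repr (ucls x)) x.
Proof. by apply/uclsP; rewrite urepr. Qed.

Definition uadd (x y : Uqso3) := ucls (repr x + repr y)%ut.
Definition umul (x y : Uqso3) := ucls (repr x * repr y)%ut.
Definition uopp (x : Uqso3) := ucls ((- 1)%:T * repr x)%ut.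
Definition uscale (c : C) (x : Uqso3) := ucls (c%:T * repr x)%ut.

Lemma uaddE x y : uadd (ucls x) (ucls y) = ucls (x + y)%ut.
Proof. by apply/uclsP; apply: ueq_add; apply: ucls_repr. Qed.
Lemma umulE x y : umul (ucls x) (ucls y) = ucls (x * y)%ut.
Proof. by apply/uclsP; apply: ueq_mul; apply: ucls_repr. Qed.
Lemma uoppE x : uopp (ucls x) = ucls ((- 1)%:T * x)%ut.
Proof. by apply/uclsP; apply: ueq_mul (ucls_repr _); apply: ueq_refl. Qed.
Lemma uscaleE c x : uscale c (ucls x) = ucls (c%:T * x)%ut.
Proof. by apply/uclsP; apply: ueq_mul (ucls_repr _); apply: ueq_refl. Qed.
Let uE := (uaddE, umulE, uoppE, uscaleE).

Lemma uaddA : associative uadd.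
Proof.
elim/uind=> x; elim/uind=> y; elim/uind=> z.
by rewrite !uE; apply/uclsP/ueq_addA.
Qed.
Lemma uaddC : commutative uadd.
Proof.
by elim/uind=> x; elim/uind=> y; rewrite !uE; apply/uclsP/ueq_addC.
Qed.
Lemma uadd0 : left_id (ucls (TConst 0)) uadd.
Proof. by elim/uind=> x; rewrite !uE; apply/uclsP/ueq_add0. Qed.
Lemma uaddN : left_inverse (ucls (TConst 0)) uopp uadd.
Proof. by elim/uind=> x; rewrite !uE; apply/uclsP/ueq_addN. Qed.

HB.instance Definition _ := GRing.isZmodule.Build Uqso3 uaddA uaddC uadd0 uaddN.

Lemma ucls_add (x y : uterm) : (ucls x : Uqso3) + ucls y = ucls (x + y)%ut.
Proof. exact: uaddE. Qed.

Lemma umulA : associative umul.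
Proof.
elim/uind=> x; elim/uind=> y; elim/uind=> z.
by rewrite !uE; apply/uclsP/ueq_mulA.
Qed.
Lemma umul1l : left_id (ucls (TConst 1)) umul.
Proof. by elim/uind=> x; rewrite !uE; apply/uclsP/ueq_mul1. Qed.
Lemma umul1r : right_id (ucls (TConst 1)) umul.
Proof.
elim/uind=> x; rewrite !uE; apply/uclsP.
by apply: ueq_trans (ueq_mul1 x); apply/ueq_sym/ueq_constC.
Qed.
Lemma umulDl : left_distributive umul uadd.
Proof.
elim/uind=> x; elim/uind=> y; elim/uind=> z.
by rewrite !uE; apply/uclsP/ueq_mulDl.
Qed.
Lemma umulDr : right_distributive umul uadd.
Proof.
elim/uind=> x; elim/uind=> y; elim/uind=> z.
by rewrite !uE; apply/uclsP/ueq_mulDr.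
Qed.

(* The character sending the three generators to 0 shows that 1 <> 0. *)
Fixpoint uaug (t : uterm) : C :=
  match t with
  | TConst c => c
  | TAdd x y => uaug x + uaug y
  | TMul x y => uaug x * uaug y
  | _ => 0
  end.

Lemma uaugP x y : ueq x y -> uaug x = uaug y.
Proof.
by elim=> //= *; rewrite ?(mulr0, addr0) //;
  solve [congruence | ring | etransitivity; eassumption].
Qed.

Lemma uone_neq0 : ucls (TConst 1) != 0 :> Uqso3.
Proof.
by apply/eqP => /uclsP/uaugP /= /eqP; rewrite oner_eq0.
Qed.

HB.instance Definition _ := GRing.Zmodule_isNzRing.Build Uqso3
  umulA umul1l umul1r umulDl umulDr uone_neq0.

Lemma uscaleA a b v : uscale a (uscale b v) = uscale (a * b) v.
Proof.
elim/uind: v => v; rewrite !uE; apply/uclsP.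
apply: ueq_trans (ueq_mulA _ _ _) _.
by apply: ueq_mul (ueq_refl _); apply/ueq_sym/ueq_constM.
Qed.
Lemma uscale1 : left_id 1 uscale.
Proof. by elim/uind=> v; rewrite !uE; apply/uclsP/ueq_mul1. Qed.
Lemma uscaleDr : right_distributive uscale +%R.
Proof.
move=> a; elim/uind=> x; elim/uind=> y.
by rewrite !(uE, ucls_add); apply/uclsP/ueq_mulDr.
Qed.
Lemma uscaleDl v : {morph uscale^~ v : a b / a + b}.
Proof.
elim/uind: v => v a b; rewrite !(uE, ucls_add); apply/uclsP.
apply: ueq_trans (ueq_mulDl _ _ _).
by apply: ueq_mul (ueq_refl _); apply: ueq_constD.
Qed.

HB.instance Definition _ := GRing.Zmodule_isLmodule.Build C Uqso3
  uscaleA uscale1 uscaleDr uscaleDl.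

Lemma uscaleAl (a : C) (x y : Uqso3) : a *: (x * y) = (a *: x) * y.
Proof.
elim/uind: x y => x; elim/uind=> y.
change (uscale a (umul (ucls x) (ucls y)) = umul (uscale a (ucls x)) (ucls y)).
by rewrite !uE; apply/uclsP/ueq_mulA.
Qed.
HB.instance Definition _ := GRing.Lmodule_isLalgebra.Build C Uqso3 uscaleAl.

Lemma uscaleAr (a : C) (x y : Uqso3) : a *: (x * y) = x * (a *: y).
Proof.
elim/uind: x y => x; elim/uind=> y.
change (uscale a (umul (ucls x) (ucls y)) = umul (ucls x) (uscale a (ucls y))).
rewrite !uE; apply/uclsP.
apply: ueq_trans (ueq_mulA _ _ _) _; apply: ueq_sym.
apply: ueq_trans (ueq_mulA _ _ _) _.
by apply: ueq_mul (ueq_refl _); apply/ueq_sym/ueq_constC.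
Qed.
HB.instance Definition _ := GRing.Lalgebra_isAlgebra.Build C Uqso3 uscaleAr.

Definition I1 : Uqso3 := ucls TI1.
Definition I2 : Uqso3 := ucls TI2.
Definition I3 : Uqso3 := ucls TI3.

Let relE (x y z : uterm) :
    ueq ((qpow lnq (1 / 2))%:T * (x * y)
         + (- qpow lnq (- (1 / 2)))%:T * (y * x))%ut z ->
  qpow lnq (1 / 2) *: (ucls x * ucls y)
  - qpow lnq (- (1 / 2)) *: (ucls y * ucls x) = ucls z :> Uqso3.
Proof.
move=> xyz; rewrite -scaleNr -(proj2 (uclsP _ _) xyz) -ucls_add.
by rewrite -!uscaleE -!umulE.
Qed.

Lemma uqso3_rel12 : qpow lnq (1 / 2) *: (I1 * I2)
  - qpow lnq (- (1 / 2)) *: (I2 * I1) = I3.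
Proof. exact/relE/ueq_rel12. Qed.
Lemma uqso3_rel23 : qpow lnq (1 / 2) *: (I2 * I3)
  - qpow lnq (- (1 / 2)) *: (I3 * I2) = I1.
Proof. exact/relE/ueq_rel23. Qed.
Lemma uqso3_rel31 : qpow lnq (1 / 2) *: (I3 * I1)
  - qpow lnq (- (1 / 2)) *: (I1 * I3) = I2.
Proof. exact/relE/ueq_rel31. Qed.

End Algebra.
Arguments ucls {R lnq} x.
Arguments I1 {R lnq}.
Arguments I2 {R lnq}.
Arguments I3 {R lnq}.

Section Representations.
Variables (K : fieldType) (A : algType K).

Record rep : Type := Rep {
  rep_space :> lmodType K;
  rep_act : A -> {linear rep_space -> rep_space};
  rep_act_linear : forall (c : K) (a b : A) (v : rep_space),
    rep_act (c *: a + b) v = c *: rep_act a v + rep_act b v;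
  rep_act1 : forall v : rep_space, rep_act 1 v = v;
  rep_actM : forall (a b : A) (v : rep_space),
    rep_act (a * b) v = rep_act a (rep_act b v) }.

Definition irreducible (r : rep) : Prop :=
  (exists v : r, v != 0) /\
  forall S : {pred r}, submod_closed S ->
    (forall a v, v \in S -> rep_act r a v \in S) ->
    (forall v, v \in S -> v = 0) \/ (forall v, v \in S).

Definition equivalent (r1 r2 : rep) : Prop :=
  exists f : {linear r1 -> r2},
    bijective f /\ forall a v, f (rep_act r1 a v) = rep_act r2 a (f v).

End Representations.

Section Span.
Variables (K : fieldType) (V : lmodType K) (X : V -> Prop).

Definition span : {pred V} := fun v =>
  `[< exists s : seq (K * V),
        (forall p, p \in s -> X p.2) /\ v = \sum_(p <- s) p.1 *: p.2 >].

Lemma mem_span v : X v -> v \in span.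
Proof.
move=> Xv; apply/asboolP; exists [:: (1, v)]; split.
  by move=> p; rewrite inE => /eqP ->.
by rewrite big_seq1 scale1r.
Qed.

Lemma span_closed : submod_closed span.
Proof.
split; first by apply/asboolP; exists [::]; rewrite big_nil.
move=> c u v /asboolP[s [Xs ->]] /asboolP[t [Xt ->]]; apply/asboolP.
exists ([seq (c * p.1, p.2) | p <- s] ++ t); split.
  by move=> p; rewrite mem_cat => /orP[/mapP[r /Xs Xr ->]|/Xt].
rewrite big_cat big_map scaler_sumr /=; congr (_ + _).
by apply: eq_bigr => p _; rewrite scalerA.
Qed.

HB.instance Definition _ := GRing.isSubmodClosed.Build K V span span_closed.

Lemma span_stable (f : {linear V -> V}) :
  (forall v, X v -> f v \in span) -> forall v, v \in span -> f v \in span.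
Proof.
move=> fX v /asboolP[s [Xs ->]]; rewrite linear_sum big_seq.
by apply: rpred_sum => p /Xs Xp; rewrite linearZ rpredZ // fX.
Qed.

Record span_space := SpanSpace {
  span_val : V;
  span_valP : span_val \in span }.

HB.instance Definition _ := [isSub for span_val].
HB.instance Definition _ := [Choice of span_space by <:].
HB.instance Definition _ := [SubChoice_isSubLmodule of span_space by <:].

End Span.

Section SubRepresentation.
Variables (K : fieldType) (A : algType K) (r : rep A) (X : r -> Prop).
Hypothesis invX : forall a v, v \in span X -> rep_act r a v \in span X.

Definition subrep_fun (a : A) (v : span_space X) : span_space X :=
  SpanSpace (invX a (span_valP v)).

Lemma subrep_fun_linear a : linear (subrep_fun a).
Proof. by move=> c u v; apply: val_inj; rewrite /= linearP. Qed.
HB.instance Definition _ a :=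
  GRing.isLinear.Build K _ _ _ (subrep_fun a) (subrep_fun_linear a).

Definition subrep_act (a : A) : {linear span_space X -> span_space X} :=
  subrep_fun a.

Lemma subrep_act_linear (c : K) (a b : A) (v : span_space X) :
  subrep_act (c *: a + b) v = c *: subrep_act a v + subrep_act b v.
Proof. by apply: val_inj; rewrite /= rep_act_linear. Qed.
Lemma subrep_act1 (v : span_space X) : subrep_act 1 v = v.
Proof. by apply: val_inj; rewrite /= rep_act1. Qed.
Lemma subrep_actM (a b : A) (v : span_space X) :
  subrep_act (a * b) v = subrep_act a (subrep_act b v).
Proof. by apply: val_inj; rewrite /= rep_actM. Qed.

Definition subrep : rep A :=
  Rep subrep_act_linear subrep_act1 subrep_actM.

End SubRepresentation.

(* A representation of U_q(so_3) from the operators J1, J2 of I_1, I_2; the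
   operator of I_3 is given by the first defining relation. *)
Section RepOfOperators.
Variables (R : realType) (lnq : R[i]) (V : lmodType R[i]).
Variables (J1 J2 : {linear V -> V}).
Local Notation s := (qpow lnq (1 / 2)).
Local Notation s' := (qpow lnq (- (1 / 2))).

Definition op_I3 (v : V) : V := s *: J1 (J2 v) - s' *: J2 (J1 v).

Hypothesis rel23 : forall v, s *: J2 (op_I3 v) - s' *: op_I3 (J2 v) = J1 v.
Hypothesis rel31 : forall v, s *: op_I3 (J1 v) - s' *: J1 (op_I3 v) = J2 v.

Fixpoint uact (t : uterm R) (v : V) : V :=
  match t with
  | TI1 => J1 v
  | TI2 => J2 v
  | TI3 => op_I3 v
  | TConst c => c *: v
  | TAdd x y => uact x v + uact y v
  | TMul x y => uact x (uact y v)
  end.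

Lemma op_I3_linear : linear op_I3.
Proof.
move=> c u v; rewrite /op_I3 (linearP J1) (linearP J2) (linearP J1) (linearP J2).
rewrite !scalerDr !scalerN !scalerA ![_ * c]mulrC opprD.
by rewrite addrACA.
Qed.

Lemma uact_linear t : linear (uact t).
Proof.
elim: t => [|||d|x IHx y IHy|x IHx y IHy] c u v /=.
- by rewrite linearP.
- by rewrite linearP.
- exact: op_I3_linear.
- by rewrite scalerDr !scalerA mulrC.
- by rewrite IHx IHy scalerDr addrACA.
- by rewrite IHy IHx.
Qed.
HB.instance Definition _ t :=
  GRing.isLinear.Build R[i] V V _ (uact t) (uact_linear t).

Lemma uactP x y : ueq lnq x y -> forall v, uact x v = uact y v.
Proof.
elim=> [ {}x // | {}x {}y _ IH v | {}y {}x z _ IH1 _ IH2 v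
       | {}x x' {}y y' _ IH1 _ IH2 v | {}x x' {}y y' _ IH1 _ IH2 v
       | {}x {}y z v | {}x {}y v | {}x v | {}x v | {}x {}y z v | {}x v
       | {}x {}y z v | {}x {}y z v | a b v | a b v | a {}x v | v | v | v] /=.
- by rewrite IH.
- by rewrite IH1.
- by rewrite IH1 IH2.
- by rewrite IH2 IH1.
- by rewrite addrA.
- by rewrite addrC.
- by rewrite scale0r add0r.
- by rewrite scaleN1r addNr scale0r.
- by [].
- by rewrite scale1r.
- by [].
- by rewrite linearD.
- by rewrite scalerDl.
- by rewrite scalerA.
- by rewrite linearZ.
- by rewrite scaleNr.
- by rewrite scaleNr rel23.
- by rewrite scaleNr rel31.
Qed.

Definition ops_act (a : Uqso3 lnq) : {linear V -> V} := uact (repr a).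

Lemma ops_actE t v : ops_act (ucls t) v = uact t v.
Proof. exact/uactP/ucls_repr. Qed.

Lemma ops_act_linear (c : R[i]) (a b : Uqso3 lnq) v :
  ops_act (c *: a + b) v = c *: ops_act a v + ops_act b v.
Proof.
elim/uind: a; elim/uind: b => y x.
have -> : c *: (ucls x : Uqso3 lnq) + ucls y = ucls (TAdd (TMul (TConst c) x) y).
  by rewrite -uaddE -uscaleE.
by rewrite !ops_actE.
Qed.
Lemma ops_act1 v : ops_act 1 v = v.
Proof. by rewrite (ops_actE (TConst 1)) /= scale1r. Qed.
Lemma ops_actM (a b : Uqso3 lnq) v :
  ops_act (a * b) v = ops_act a (ops_act b v).
Proof.
elim/uind: a; elim/uind: b => y x.
have -> : (ucls x : Uqso3 lnq) * ucls y = ucls (TMul x y) by rewrite -umulE.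
by rewrite !ops_actE.
Qed.

Definition rep_of_ops : rep (Uqso3 lnq) :=
  Rep ops_act_linear ops_act1 ops_actM.

Lemma rep_of_ops_stable (X : V -> Prop) :
  (forall v, X v -> J1 v \in span X) -> (forall v, X v -> J2 v \in span X) ->
  forall a (v : rep_of_ops), v \in span X -> rep_act rep_of_ops a v \in span X.
Proof.
move=> X1 X2; elim/uind=> t v; rewrite [rep_act _ _ _]ops_actE.
have S1 := span_stable X1; have S2 := span_stable X2.
elim: t v => [|||d|x IHx y IHy|x IHx y IHy] v Sv /=; rewrite ?S1 ?S2 //.
- by rewrite /op_I3 rpredB // rpredZ // ?S1 ?S2 // ?S1 ?S2.
- by rewrite rpredZ.
- by rewrite rpredD ?IHx ?IHy.
- by rewrite IHx ?IHy.
Qed.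

End RepOfOperators.

Section BasisExtension.
Variables (K : fieldType) (I : choiceType) (V : lmodType K).

(* {freeg I / K}, the finitely supported functions I -> K, is the vector space
   with basis the vectors << i >>. *)
Definition basis_ext (f : I -> V) (x : {freeg I / K}) : V := fglift f x.

Lemma basis_extB (f : I -> V) : {morph basis_ext f : x y / x - y}.
Proof. by move=> x y; apply: lift_is_additive. Qed.

Lemma basis_extE (f : I -> V) i : basis_ext f << i >> = f i.
Proof. by rewrite /basis_ext liftU scale1r. Qed.

Lemma basis_ext_linear (f : I -> V) : linear (basis_ext f).
Proof.
have f0 : basis_ext f 0 = 0 by rewrite -(subrr 0) basis_extB subrr.
have fN x : basis_ext f (- x) = - basis_ext f x.
  by rewrite -sub0r basis_extB f0 sub0r.
have fD x y : basis_ext f (x + y) = basis_ext f x + basis_ext f y.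
  by rewrite -{1}[y]opprK basis_extB fN opprK.
move=> c u v; rewrite fD; congr (_ + _).
rewrite -[in RHS](freeg_sumE u) [c *: u]/(fgscale c u) /fgscale.
rewrite !(big_morph _ fD f0) scaler_sumr; apply: eq_bigr => i _.
by rewrite /basis_ext !liftU scalerA.
Qed.
HB.instance Definition _ f :=
  GRing.isLinear.Build K _ _ _ (basis_ext f) (basis_ext_linear f).

Lemma freeg_linear_ext (f g : {linear {freeg I / K} -> V}) :
  (forall i, f << i >> = g << i >>) -> f =1 g.
Proof.
move=> fg x; rewrite -(freeg_sumE x) !linear_sum; apply: eq_bigr => i _.
have -> : << coeff i x *g i >> = coeff i x *: << i >> :> {freeg I / K}.
  by apply/eqP/freeg_eqP=> j; rewrite coeffZ !coeffU mul1r.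
by rewrite !linearZ fg.
Qed.

End BasisExtension.

Lemma scalar_rels (K : fieldType) (e t l x : K)
    (a := fun y => e * ((l * y + l^-1 * y^-1) / (t ^+ 2 - (t ^+ 2)^-1)))
    (c := 1 / (t ^+ 2 - (t ^+ 2)^-1))
    (u := fun y => c * (t * a (y * t ^+ 2) - t^-1 * a y))
    (d := fun y => c * (t * a (y / t ^+ 2) - t^-1 * a y)) :
  e * e = 1 -> t != 0 -> l != 0 -> x != 0 ->
  [/\ c * (t * u x - t^-1 * u (x * t ^+ 2)) = 0,
      c * (t * d x - t^-1 * d (x / t ^+ 2)) = 0,
      c * (t * u x + t * d x - t^-1 * d (x * t ^+ 2) - t^-1 * u (x / t ^+ 2))
        = a x,
      u x * (t * a x - t^-1 * a (x * t ^+ 2)) = c &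
      d x * (t * a x - t^-1 * a (x / t ^+ 2)) = c].
Proof.
move=> e2 t0 l0 x0; rewrite /u /d /a /c => {u d a c}.
have [->|t2] := eqVneq (t ^+ 2 - (t ^+ 2)^-1) 0.
  by rewrite invr0 !(mulr0, mul0r).
have t4 : t ^+ 2 * t ^+ 2 - 1 != 0.
  apply: contra t2 => /eqP t4; apply/eqP/(mulIf (expf_neq0 2 t0)).
  by rewrite mul0r mulrBl mulVf ?expf_neq0.
split; try by field; rewrite ?t0 ?l0 ?x0 ?t4.
- transitivity ((e * e) * (1 / (t ^+ 2 - (t ^+ 2)^-1))); last by rewrite e2 mul1r.
  by field; rewrite ?t0 ?l0 ?x0 ?t4.
- transitivity ((e * e) * (1 / (t ^+ 2 - (t ^+ 2)^-1))); last by rewrite e2 mul1r.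
  by field; rewrite ?t0 ?l0 ?x0 ?t4.
Qed.

Section QRepresentations.
Variables (R : realType) (lnq : R[i]).
Local Notation C := R[i].
Local Notation q := (cexp lnq).
Local Notation s := (qpow lnq (1 / 2)).
Local Notation s' := (qpow lnq (- (1 / 2))).

Definition admissible (lam : C) : Prop :=
  exists tau : C, 0 <= complex.Re tau < 1 /\ lam = qpow lnq tau.

Local Notation H := {freeg int / C}.

Definition ket (m : int) : H := << m >>.

(* The sign is encoded as a boolean b, standing for (-1) ^ b: Q^+ is b = false
   and Q^- is b = true. *)
Definition Q_I1 (b : bool) (lam : C) : {linear H -> H} :=
  basis_ext (fun m : int =>
    ((-1) ^+ b * ((lam * q ^ m + lam^-1 * q ^ (- m)) / (q - q^-1))) *: ket m).

Definition Q_I2 : {linear H -> H} :=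
  basis_ext (fun m : int =>
    (1 / (q - q^-1)) *: ket (m + 1) + (1 / (q - q^-1)) *: ket (m - 1)).

Lemma q_sqr : q = s ^+ 2.
Proof. by rewrite -qpow1 /qpow mul1r. Qed.

Lemma admissible_neq0 lam : admissible lam -> lam != 0.
Proof. by move=> [tau [_ ->]]; apply: qpow_neq0. Qed.

Lemma Q_I1E b lam m : Q_I1 b lam (ket m) =
  ((-1) ^+ b * ((lam * q ^ m + lam^-1 * q ^ (- m)) / (q - q^-1))) *: ket m.
Proof. exact: basis_extE. Qed.

Lemma Q_I2E m : Q_I2 (ket m) =
  (1 / (q - q^-1)) *: ket (m + 1) + (1 / (q - q^-1)) *: ket (m - 1).
Proof. exact: basis_extE. Qed.

Lemma ket_comb_eq (u v : H) : (forall i, coeff i u = coeff i v) -> u = v.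
Proof. by move=> uv; apply/eqP/freeg_eqP. Qed.

Section Relations.
Variables (b : bool) (lam : C).
Hypothesis lam0 : lam != 0.
Local Notation J1 := (Q_I1 b lam).
Local Notation J2 := Q_I2.
Local Notation J3 := (op_I3 lnq J1 J2).

Lemma J3D u v : J3 (u + v) = J3 u + J3 v.
Proof. by have := op_I3_linear lnq J1 J2 1 u v; rewrite !scale1r. Qed.
Lemma J3Z c u : J3 (c *: u) = c *: J3 u.
Proof.
have J30 : J3 0 = 0 by rewrite /op_I3 !linear0 ?subrr ?addr0.
by have := op_I3_linear lnq J1 J2 c u 0; rewrite addr0 J30 addr0.
Qed.


Let a m : C := (-1) ^+ b * ((lam * q ^ m + lam^-1 * q ^ (- m)) / (q - q^-1)).
Let c : C := 1 / (q - q^-1).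
Let u m : C := c * (s * a (m + 1) - s' * a m).
Let d m : C := c * (s * a (m - 1) - s' * a m).

Lemma J1D x y : J1 (x + y) = J1 x + J1 y. Proof. exact: linearD. Qed.
Lemma J1Z k x : J1 (k *: x) = k *: J1 x. Proof. exact: linearZ. Qed.
Lemma J2D x y : J2 (x + y) = J2 x + J2 y. Proof. exact: linearD. Qed.
Lemma J2Z k x : J2 (k *: x) = k *: J2 x. Proof. exact: linearZ. Qed.
Lemma J1E m : J1 (ket m) = a m *: ket m. Proof. exact: Q_I1E. Qed.
Lemma J2E m : J2 (ket m) = c *: ket (m + 1) + c *: ket (m - 1).
Proof. exact: Q_I2E. Qed.

Lemma J3E m : J3 (ket m) = u m *: ket (m + 1) + d m *: ket (m - 1).
Proof.
rewrite /op_I3 J1E J2E J1D J2Z !J1Z J2E !J1E.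
apply: ket_comb_eq => i; rewrite !(coeffB, coeffD, coeffZ).
by rewrite /u /d; ring.
Qed.


Lemma Q_scalar_rels m :
  [/\ c * (s * u m - s' * u (m + 1)) = 0,
      c * (s * d m - s' * d (m - 1)) = 0,
      c * (s * u m + s * d m - s' * d (m + 1) - s' * u (m - 1)) = a m,
      u m * (s * a m - s' * a (m + 1)) = c &
      d m * (s * a m - s' * a (m - 1)) = c].
Proof.
have q0 : q != 0 by rewrite cexp_neq0.
have qN k : q ^ (- k) = (q ^ k)^-1 by rewrite invr_expz.
have qD k : q ^ (k + 1) = q ^ k * q by rewrite exprzDr ?expr1z ?unitfE.
have qB k : q ^ (k - 1) = q ^ k / q by rewrite exprzDr ?unitfE.
rewrite /u /d /a /c !qN !(qD, qB) qpowN q_sqr.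
apply: scalar_rels; rewrite ?qpow_neq0 ?expfz_neq0 ?expf_neq0 ?qpow_neq0 //.
by rewrite -expr2 sqrr_sign.
Qed.

Lemma Q_rel23 v : s *: J2 (J3 v) - s' *: J3 (J2 v) = J1 v.
Proof.
pose f w := s *: J2 (J3 w) - s' *: J3 (J2 w).
have f_lin : linear f.
  move=> k x y; rewrite /f (J3D (k *: x)) J3Z (J2D (k *: x)) J2Z.
  rewrite (J2D (k *: J3 x)) J2Z (J3D (k *: J2 x)) J3Z.
  by apply: ket_comb_eq => i; rewrite !(coeffB, coeffD, coeffZ); ring.
pose F : {linear H -> H} :=
  HB.pack f (GRing.isLinear.Build C H H _ f f_lin).
apply: (@freeg_linear_ext _ _ _ F J1) => m; rewrite /F /= /f.
rewrite -/(ket m) J3E J2E J2D J3D !J2Z !J3Z !J2E !J3E J1E.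
have [r1 r2 r3 _ _] := Q_scalar_rels m.
apply: ket_comb_eq => i; rewrite !(coeffB, coeffD, coeffZ).
rewrite !addrK ?subrK -r3.
move: (coeff i (ket m)) (coeff i (ket (m + 1 + 1))) (coeff i (ket (m - 1 - 1))).
move=> x y z; apply/eqP; rewrite -subr_eq0; apply/eqP.
transitivity (c * (s * u m - s' * u (m + 1)) * y
              + c * (s * d m - s' * d (m - 1)) * z); first by ring.
by rewrite r1 r2 !mul0r addr0.
Qed.

Lemma Q_rel31 v : s *: J3 (J1 v) - s' *: J1 (J3 v) = J2 v.
Proof.
pose f w := s *: J3 (J1 w) - s' *: J1 (J3 w).
have f_lin : linear f.
  move=> k x y; rewrite /f (J3D (k *: x)) J3Z (J1D (k *: x)) J1Z.
  rewrite (J1D (k *: J3 x)) J1Z (J3D (k *: J1 x)) J3Z.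
  by apply: ket_comb_eq => i; rewrite !(coeffB, coeffD, coeffZ); ring.
pose F : {linear H -> H} :=
  HB.pack f (GRing.isLinear.Build C H H _ f f_lin).
apply: (@freeg_linear_ext _ _ _ F J2) => m; rewrite /F /= /f.
rewrite -/(ket m) J3E J1E J1D J3Z !J1Z !J1E J3E J2E.
have [_ _ _ r4 r5] := Q_scalar_rels m.
apply: ket_comb_eq => i; rewrite !(coeffB, coeffD, coeffZ).
by rewrite -{1}r4 -{1}r5; ring.
Qed.

End Relations.

Definition Q (b : bool) (lam : C) (adm : admissible lam) : rep (Uqso3 lnq) :=
  rep_of_ops (Q_rel23 b (admissible_neq0 adm))
             (Q_rel31 b (admissible_neq0 adm)).

Lemma Q_actI1 b lam (adm : admissible lam) (v : Q b adm) :
  rep_act _ I1 v = Q_I1 b lam v.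
Proof.
exact: (ops_actE (Q_rel23 b (admissible_neq0 adm))
  (Q_rel31 b (admissible_neq0 adm)) (TI1 R) v).
Qed.

Lemma Q_actI2 b lam (adm : admissible lam) (v : Q b adm) :
  rep_act _ I2 v = Q_I2 v.
Proof.
exact: (ops_actE (Q_rel23 b (admissible_neq0 adm))
  (Q_rel31 b (admissible_neq0 adm)) (TI2 R) v).
Qed.

Lemma admissible_1 : admissible 1.
Proof.
exists 0; rewrite /= lexx ltr01; split=> //.
by rewrite /qpow mul0r cexp0.
Qed.

Lemma admissible_sqrt : admissible (qpow lnq (1 / 2)).
Proof.
exists (1 / 2); split=> //.
have -> : (1 / 2 : C) = (1 / 2)%:C by rewrite rmorphM rmorph1 fmorphV rmorph_nat.
by rewrite /= divr_ge0 ?ler01 ?ler0n //= ltr_pdivrMr ?ltr0n // mul1r ltr1n.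
Qed.

Definition V1 (v : H) : Prop :=
  v = ket 0 \/ exists m : int, 1 <= m /\ v = ket m + ket (- m).
Definition V2 (v : H) : Prop :=
  exists m : int, 1 <= m /\ v = ket m - ket (- m).
Definition W1 (v : H) : Prop :=
  exists m : int, 0 <= m /\ v = ket m - ket (- m - 1).
Definition W2 (v : H) : Prop :=
  exists m : int, 0 <= m /\ v = ket m + ket (- m - 1).

Lemma V1_ket m : ket m + ket (- m) \in span V1.
Proof.
have [m1|m1|<-] := ltgtP 0 m.
- by apply: mem_span; right; exists m.
- rewrite addrC -[in ket m](opprK m); apply: mem_span; right.
  by exists (- m); split; rewrite // -gtz0_ge1 oppr_gt0.
- by rewrite oppr0 rpredD // mem_span //; left.
Qed.

Lemma V2_ket m : ket m - ket (- m) \in span V2.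
Proof.
have [m1|m1|<-] := ltgtP 0 m.
- by apply: mem_span; exists m.
- rewrite -opprB rpredN -[in ket m](opprK m); apply: mem_span.
  by exists (- m); split; rewrite // -gtz0_ge1 oppr_gt0.
- by rewrite oppr0 subrr rpred0.
Qed.

Lemma W1_ket m : ket m - ket (- m - 1) \in span W1.
Proof.
have [m0|m0] := leP 0 m; first by apply: mem_span; exists m.
rewrite -opprB rpredN; apply: mem_span; exists (- m - 1); split; first by lia.
by congr (_ - ket _); lia.
Qed.

Lemma W2_ket m : ket m + ket (- m - 1) \in span W2.
Proof.
have [m0|m0] := leP 0 m; first by apply: mem_span; exists m.
rewrite addrC; apply: mem_span; exists (- m - 1); split; first by lia.
by congr (_ + ket _); lia.
Qed.

Lemma Q_I1_opp (b : bool) m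
    (e := (-1) ^+ b * ((1 * q ^ m + 1^-1 * q ^ (- m)) / (q - q^-1))) :
  Q_I1 b 1 (ket m) = e *: ket m /\ Q_I1 b 1 (ket (- m)) = e *: ket (- m).
Proof.
split; rewrite Q_I1E /e invr1 !mul1r //.
by rewrite opprK [q ^ (- m) + _]addrC.
Qed.

Lemma Q_I1_refl (b : bool) m
    (e := (-1) ^+ b * ((s * q ^ m + s^-1 * q ^ (- m)) / (q - q^-1))) :
  Q_I1 b s (ket m) = e *: ket m /\
  Q_I1 b s (ket (- m - 1)) = e *: ket (- m - 1).
Proof.
split; rewrite Q_I1E // /e; congr (_ * (_ / _) *: _).
have q0 : q != 0 by apply: cexp_neq0.
have EP : q ^ (- (- m - 1)) = q ^ m * q.
  by rewrite opprB opprK addrC exprzDr ?unitfE // expr1z.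
have EN : q ^ (- m - 1) = (q ^ m)^-1 * q^-1.
  by rewrite -opprD -invr_expz exprzDr ?unitfE // expr1z invfM.
rewrite EN EP -invr_expz.
have := expfz_neq0 m q0; move: (q ^ m) => x x0.
have s0 := qpow_neq0 lnq (1 / 2).
rewrite q_sqr; move: s s0 => t t0.
by field; rewrite x0 t0.
Qed.

Lemma V1_stable b a (v : Q b admissible_1) :
  v \in span V1 -> rep_act _ a v \in span V1.
Proof.
apply: rep_of_ops_stable => {}v.
  have V1_I1 m : Q_I1 b 1 (ket m + ket (- m)) \in span V1.
    have [E1 E2] := Q_I1_opp b m.
    by rewrite linearD E1 E2 -scalerDr rpredZ // V1_ket.
  case=> [->|[m [_ ->]] //].
  by rewrite Q_I1E rpredZ // mem_span //; left.
have V1_I2 m : Q_I2 (ket m + ket (- m)) \in span V1.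
  rewrite linearD !Q_I2E -!scalerDr rpredZ //.
  rewrite [_ + ket (- m - 1)]addrC addrACA.
  have -> : - m - 1 = - (m + 1) by lia.
  have -> : - m + 1 = - (m - 1) by lia.
  by rewrite rpredD // V1_ket.
case=> [->|[m [_ ->]] //].
rewrite Q_I2E -scalerDr rpredZ // add0r sub0r; exact: V1_ket.
Qed.

Lemma V2_stable b a (v : Q b admissible_1) :
  v \in span V2 -> rep_act _ a v \in span V2.
Proof.
apply: rep_of_ops_stable => {}v [m [_ ->]].
  have [E1 E2] := Q_I1_opp b m.
  by rewrite linearB E1 E2 -scalerBr rpredZ // V2_ket.
rewrite linearB !Q_I2E -!scalerDr -scalerBr rpredZ //.
rewrite opprD [- ket (- m + 1) - _]addrC addrACA.
have -> : - m - 1 = - (m + 1) by lia.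
have -> : - m + 1 = - (m - 1) by lia.
by rewrite rpredD // V2_ket.
Qed.

Lemma W1_stable b a (v : Q b admissible_sqrt) :
  v \in span W1 -> rep_act _ a v \in span W1.
Proof.
apply: rep_of_ops_stable => {}v [m [_ ->]].
  have [E1 E2] := Q_I1_refl b m.
  by rewrite linearB E1 E2 -scalerBr rpredZ // W1_ket.
rewrite linearB !Q_I2E -!scalerDr -scalerBr rpredZ //.
rewrite opprD [- ket (- m - 1 + 1) - _]addrC addrACA.
have -> : - m - 1 - 1 = - (m + 1) - 1 by lia.
have -> : - m - 1 + 1 = - (m - 1) - 1 by lia.
by rewrite rpredD // W1_ket.
Qed.

Lemma W2_stable b a (v : Q b admissible_sqrt) :
  v \in span W2 -> rep_act _ a v \in span W2.
Proof.
apply: rep_of_ops_stable => {}v [m [_ ->]].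
  have [E1 E2] := Q_I1_refl b m.
  by rewrite linearD E1 E2 -scalerDr rpredZ // W2_ket.
rewrite linearD !Q_I2E -!scalerDr rpredZ //.
rewrite [ket (- m - 1 + 1) + _]addrC addrACA.
have -> : - m - 1 - 1 = - (m + 1) - 1 by lia.
have -> : - m - 1 + 1 = - (m - 1) - 1 by lia.
by rewrite rpredD // W2_ket.
Qed.

Definition Q_1_1 b : rep (Uqso3 lnq) := subrep (@V1_stable b).
Definition Q_1_2 b : rep (Uqso3 lnq) := subrep (@V2_stable b).
Definition Q_sqrt_1 b : rep (Uqso3 lnq) := subrep (@W1_stable b).
Definition Q_sqrt_2 b : rep (Uqso3 lnq) := subrep (@W2_stable b).

Variant sub_label : Set := Sub_1_1 | Sub_1_2 | Sub_sqrt_1 | Sub_sqrt_2.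

Definition Q_sub (l : sub_label) (b : bool) : rep (Uqso3 lnq) :=
  match l with
  | Sub_1_1 => Q_1_1 b
  | Sub_1_2 => Q_1_2 b
  | Sub_sqrt_1 => Q_sqrt_1 b
  | Sub_sqrt_2 => Q_sqrt_2 b
  end.

End QRepresentations.

(* Main.v *)
Require Import Defs.
From HB Require Import structures.
From mathcomp Require Import all_boot all_order all_algebra.
From mathcomp Require Import reals complex.
From mathcomp Require Import boolp freeg ring zify.
Local Open Scope ring_scope.

(** Each of the eight subrepresentations has a basis [e_0, e_1, ...] indexed by
the half-line on which [I_1] is diagonal with pairwise distinct eigenvalues
[a_0, a_1, ...] and [I_2] moves only to neighbouring sites:
[I_2 e_0 = c e_1 + delta e_0] and [I_2 e_(n+1) = c e_(n+2) + d_n e_n], with [c]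
and all [d_n] nonzero. The symmetric or antisymmetric combinations of kets are
the basis; the reflection which folds the line onto the half-line fixes a site
for [V_1] and [V_2] ([delta = 0]) and lies between two sites for [W_1] and [W_2]
([delta = - c] and [delta = c]). Distinctness of the [a_n] is where [q] not
being a root of unity enters. This structure is [half_line], and everything
else is deduced from it.

Irreducibility ([half_line_irreducible]): as the [I_1]-spectrum is simple, an
invariant subspace contains every basis vector that occurs in one of its
elements; [I_2] then carries it from any site down to [e_0] and up to all sites.

Nonequivalence ([half_line_equivalent]): an injective intertwiner sends each
eigenvector [e_n] of [I_1] to a multiple of some [e'_m]. The image of [e_0] must
be a multiple of [e'_0], since [I_2 e_0] involves one new eigenline only,
whereas [I_2 e'_m] with [m > 0] involves two. Hence the lowest eigenvalue [a_0]
and the constant [delta] are invariants of the representation. The eight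
subrepresentations are told apart by them: [delta] separates the two series
[W_1], [W_2] from each other and from the rest, and [a_0 (q - q^-1)] is
[+-2], [+-(q + q^-1)], [+-(s + s^-1)] with [s^2 = q], for [V_1], [V_2] and
[W_i].

Comparison with [Q_lambda] ([Q_not_equivalent_half_line]): an intertwiner would
send [|m>] to a multiple of [e_(sigma m)] with [sigma] injective on the
integers. Where [sigma] is minimal, both neighbours of the site go strictly up,
but [I_2] allows a single step upwards, to a single site. *)

Set Implicit Arguments.
Unset Strict Implicit.
Unset Printing Implicit Defensive.

Import GRing.Theory Num.Theory.

(** * Jacobi pairs of operators on the half-line *)

Section HalfLine.
Variable K : fieldType.

(** Spanning is phrased as an induction principle because subspaces generated by a
predicate provide it directly; with the coordinate forms it yields the finite
expansions. The coefficient [delta] is the boundary condition: it is what [J2]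
sends from the end [e_0] of the half-line back to itself. *)
Record half_line (V : lmodType K) (J1 J2 : V -> V)
    (a d : nat -> K) (c delta : K) := HalfLine {
  hl_vec : nat -> V;
  hl_coord : nat -> V -> K;
  hl_coord_linear : forall n, scalar (hl_coord n);
  hl_coord_vec : forall m n, hl_coord m (hl_vec n) = (n == m)%:R;
  hl_ind : forall (P : V -> Prop),
    (forall n, P (hl_vec n)) -> P 0 ->
    (forall k u v, P u -> P v -> P (k *: u + v)) -> forall v, P v;
  hl_J1 : forall n, J1 (hl_vec n) = a n *: hl_vec n;
  hl_J2_0 : J2 (hl_vec 0) = c *: hl_vec 1 + delta *: hl_vec 0;
  hl_J2_S : forall n,
    J2 (hl_vec n.+1) = c *: hl_vec n.+2 + d n *: hl_vec n;
  hl_a_inj : injective a;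
  hl_c_neq0 : c != 0;
  hl_d_neq0 : forall n, d n != 0 }.

Arguments hl_coord_linear {V J1 J2 a d c delta} M n : rename.
Arguments hl_coord_vec {V J1 J2 a d c delta} M m n : rename.
Arguments hl_ind {V J1 J2 a d c delta} M P : rename.
Arguments hl_J2_0 {V J1 J2 a d c delta} M : rename.
Arguments hl_J2_S {V J1 J2 a d c delta} M n : rename.
Arguments hl_a_inj {V J1 J2 a d c delta} M : rename.
Arguments hl_c_neq0 {V J1 J2 a d c delta} M : rename.
Arguments hl_d_neq0 {V J1 J2 a d c delta} M n : rename.

Section Theory.
Variables (V : lmodType K) (J1 J2 : {linear V -> V}).
Variables (a d : nat -> K) (c delta : K).
Variable M : half_line J1 J2 a d c delta.
Local Notation e := (hl_vec M).
Local Notation x := (hl_coord M).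

Lemma hl_coordD n u v : x n (u + v) = x n u + x n v.
Proof. by have := hl_coord_linear M n 1 u v; rewrite scale1r mul1r. Qed.

Lemma hl_coord0 n : x n 0 = 0.
Proof. by apply: (addIr (x n 0)); rewrite -hl_coordD !add0r. Qed.

Lemma hl_coordZ n k u : x n (k *: u) = k * x n u.
Proof.
by have := hl_coord_linear M n k u 0; rewrite hl_coord0 !addr0.
Qed.

Lemma hl_coord_sum n N (F : 'I_N -> V) :
  x n (\sum_i F i) = \sum_i x n (F i).
Proof. exact: (big_morph _ (hl_coordD n) (hl_coord0 n)). Qed.

Definition hl_coordE := (hl_coordD, hl_coordZ, hl_coord_vec M).

Lemma hl_vec_neq0 n : e n != 0.
Proof.
apply/eqP => e0; have := hl_coord_vec M n n.
by rewrite e0 hl_coord0 eqxx => /esym/eqP; rewrite oner_eq0.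
Qed.

Lemma hl_expand v : exists N, v = \sum_(n < N) x n v *: e n.
Proof.
suff [N E] : exists N, forall N', (N <= N')%N -> v = \sum_(n < N') x n v *: e n.
  by exists N; apply: E.
elim/(hl_ind M): v => [m||k u v [N1 E1] [N2 E2]].
- exists m.+1 => N ltmN; rewrite (bigD1 (Ordinal ltmN)) //= hl_coordE eqxx.
  rewrite scale1r big1 ?addr0 // => i; rewrite -val_eqE /= => im.
  by rewrite hl_coordE eq_sym (negPf im) scale0r.
- by exists 0%N => N _; rewrite big1 // => i _; rewrite hl_coord0 scale0r.
- exists (maxn N1 N2) => N; rewrite geq_max => /andP[/E1 {}E1 /E2 {}E2].
  rewrite {1}E1 {1}E2 scaler_sumr -big_split /=; apply: eq_bigr => i _.
  by rewrite !hl_coordE scalerDl scalerA.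
Qed.

Lemma hl_coord_neq0 v : v != 0 -> exists n, x n v != 0.
Proof.
move=> v0; have [N E] := hl_expand v.
have /existsP[n xn] : [exists n : 'I_N, x n v != 0]; last by exists n.
apply: contraR v0; rewrite negb_exists => /forallP x0.
by rewrite E big1 // => i _; move/negPn/eqP: (x0 i) => ->; rewrite scale0r.
Qed.

Lemma hl_coord_inj u v : (forall n, x n u = x n v) -> u = v.
Proof.
move=> uv; apply/eqP; rewrite -subr_eq0; apply/negPn/negP => /hl_coord_neq0[n].
by rewrite -scaleN1r addrC hl_coordD hl_coordZ uv mulN1r addNr eqxx.
Qed.

Lemma hl_coord_J1 n v : x n (J1 v) = a n * x n v.
Proof.
elim/(hl_ind M): v => [m||k u v Hu Hv].
- by rewrite hl_J1 !hl_coordE; case: eqP => [->//|_]; rewrite !mulr0.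
- by rewrite linear0 hl_coord0 mulr0.
- by rewrite linearP !hl_coordE Hu Hv mulrDr mulrCA.
Qed.

(** The spectrum of [J1] being simple, its eigenlines are those of the basis
vectors. *)
Lemma hl_eigenvector mu v : J1 v = mu *: v -> v != 0 ->
  exists n k, [/\ k != 0, v = k *: e n & mu = a n].
Proof.
move=> Jv v0; have eig n : x n v != 0 -> mu = a n.
  by move=> xn; apply: (mulIf xn); rewrite -hl_coordZ -Jv hl_coord_J1.
have [n xn] := hl_coord_neq0 v0.
exists n, (x n v); split; rewrite ?(eig n) //.
apply: hl_coord_inj => m; rewrite !hl_coordE.
have [<-|nm] := eqVneq n m; first by rewrite mulr1.
rewrite mulr0; apply: contraNeq nm => xm.
by apply/eqP/(hl_a_inj M); rewrite -(eig _ xn) (eig _ xm).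
Qed.

Section Invariant.
Variable S : {pred V}.
Hypothesis S_closed : submod_closed S.
Hypothesis S_J1 : forall v, v \in S -> J1 v \in S.
Hypothesis S_J2 : forall v, v \in S -> J2 v \in S.
HB.instance Definition _ := GRing.isSubmodClosed.Build K V S S_closed.

Let S_scale k v : k != 0 -> k *: v \in S -> v \in S.
Proof. by move=> k0 kv; rewrite -(scalerK k0 v) rpredZ. Qed.

(** Applying [J1 - a_N] removes the top term of a combination and multiplies the
others by the nonzero scalars [a_n - a_N], so the components can be separated by
induction on the number of terms. *)
Lemma hl_component_sum N (k : nat -> K) :
  \sum_(n < N) k n *: e n \in S ->
  forall n, (n < N)%N -> k n *: e n \in S.
Proof.
elim: N k => // N IH k Sk.
have {}IH n : (n < N)%N -> k n *: e n \in S.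
  move=> ltnN; apply: (@S_scale (a n - a N)).
    rewrite subr_eq0; apply: contraTneq ltnN => /(hl_a_inj M) ->.
    by rewrite ltnn.
  rewrite scalerA; apply: (IH (fun m => (a m - a N) * k m)) => //.
  (* The combination obtained by applying J1 - a_N. *)
  have := rpredB (S_J1 Sk) (rpredZ (a N) Sk).
  rewrite linear_sum scaler_sumr -sumrB big_ord_recr /=.
  rewrite linearZ /= hl_J1 !scalerA [_ * a N]mulrC subrr addr0.
  rewrite (eq_bigr (fun i : 'I_N => ((a i - a N) * k i) *: e i)) // => i _.
  by rewrite linearZ /= hl_J1 !scalerA mulrBl scalerBl [_ * a i]mulrC.
move=> n; rewrite ltnS leq_eqVlt => /predU1P[->|/IH//].
move: Sk; rewrite big_ord_recr /= rpredDl // rpred_sum // => i _.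
exact: IH.
Qed.

Lemma hl_component v n : v \in S -> x n v != 0 -> e n \in S.
Proof.
have [N E] := hl_expand v => Sv xn; apply: (S_scale xn).
have [ltnN|leNn] := ltnP n N.
  by apply: (hl_component_sum (N := N) (k := fun n => x n v)); rewrite -?E.
case/eqP: xn; rewrite E hl_coord_sum big1 // => i _.
by rewrite !hl_coordE ltn_eqF ?mulr0 // (leq_trans _ leNn).
Qed.

(** One basis vector of [S] is enough: [J2] has nonzero coefficients towards both
neighbours, so [hl_component] leads down to the end of the half-line, then up. *)
Lemma hl_invariant_full v : v \in S -> v != 0 -> forall u, u \in S.
Proof.
move=> Sv v0.
have [n Sn] : exists n, e n \in S.
  by have [n xn] := hl_coord_neq0 v0; exists n; apply: hl_component xn.
have {n Sn} S0 : e 0 \in S.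
  elim: n Sn => // n IH Sn; apply: IH.
  apply: hl_component (S_J2 Sn) _.
  by rewrite hl_J2_S !hl_coordE eqxx gtn_eqF // mulr0 add0r mulr1 (hl_d_neq0 M).
have S_e n : e n \in S.
  elim: n => // -[|n] Sn; apply: hl_component (S_J2 Sn) _.
    by rewrite hl_J2_0 !hl_coordE eqxx mulr0 addr0 mulr1 (hl_c_neq0 M).
  rewrite hl_J2_S !hl_coordE eqxx ltn_eqF // mulr0 addr0 mulr1.
  exact: hl_c_neq0 M.
elim/(hl_ind M) => // [|k u w Su Sw]; first exact: rpred0.
by rewrite rpredD ?rpredZ.
Qed.

End Invariant.
End Theory.

(** The image of [e_0] is a multiple of some [e'_n]. If [n] were positive,
[J2' e'_n] would have nonzero components on the two lines of [e'_(n-1)] and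
[e'_(n+1)], but the image of [J2 e_0 = c e_1 + delta e_0] meets only one line
besides that of [e'_n]. So [n = 0], and the coefficients on [e'_0] agree. *)
Lemma half_line_intertwiner (V V' : lmodType K)
    (J1 J2 : {linear V -> V}) (J1' J2' : {linear V' -> V'})
    a d c delta a' d' c' delta'
    (M : half_line J1 J2 a d c delta)
    (M' : half_line J1' J2' a' d' c' delta') (f : {linear V -> V'}) :
  injective f -> (forall v, f (J1 v) = J1' (f v)) ->
  (forall v, f (J2 v) = J2' (f v)) -> a 0 = a' 0 /\ delta = delta'.
Proof.
move=> f_inj fJ1 fJ2.
have eig n : exists m k,
    [/\ k != 0, f (hl_vec M n) = k *: hl_vec M' m & a n = a' m].
  apply: hl_eigenvector; first by rewrite -fJ1 hl_J1 linearZ.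
  by rewrite -(linear0 f) (inj_eq f_inj) hl_vec_neq0.
have [n [k [k0 E0 an]]] := eig 0; have [m [k1 [k10 E1 am]]] := eig 1.
have nm : (n == m) = false.
  apply/eqP => nm; have /(hl_a_inj M) // : a 0 = a 1 by rewrite an am nm.
have := fJ2 (hl_vec M 0).
rewrite hl_J2_0 linearD !linearZ /= E0 E1 [J2' _]linearZ /= => {eig E0 E1 am}.
case: n an nm => [|n] an nm; last first.
  rewrite (hl_J2_S M') => E; have := congr1 (hl_coord M' n) E.
  have := congr1 (hl_coord M' n.+2) E.
  have [h1 h2 h3 h4] : [/\ (n == n.+2) = false, (n.+1 == n.+2) = false,
    (n.+2 == n) = false & (n.+1 == n) = false] by split; lia.
  rewrite !hl_coordE !eqxx h1 h2 h3 h4 !(mulr0, addr0, mulr1, add0r).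
  have [->|_] := eqVneq m n.+2; last first.
    rewrite !mulr0 => /esym/eqP.
    by rewrite mulf_eq0 (negPf k0) (negPf (hl_c_neq0 M')).
  rewrite h3 !mulr0 => _ /esym/eqP.
  by rewrite mulf_eq0 (negPf k0) (negPf (hl_d_neq0 M' n)).
rewrite (hl_J2_0 M') => /(congr1 (hl_coord M' 0)).
rewrite !hl_coordE /= [m == 0]eq_sym nm !(mulr0, add0r, mulr1).
by rewrite mulrC => /(mulfI k0).
Qed.

End HalfLine.

Lemma half_line_irreducible (R : realType) (lnq : R[i])
    (r : rep (Uqso3 lnq)) a d c delta :
  half_line (rep_act r I1) (rep_act r I2) a d c delta -> irreducible r.
Proof.
move=> M; split; first by exists (hl_vec M 0); apply: hl_vec_neq0.
move=> S S_closed S_inv.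
have [[v [Sv v0]]|nS] := pselect (exists v, v \in S /\ v != 0).
  by right; apply: (hl_invariant_full M S_closed _ _ Sv v0) => u; apply: S_inv.
left=> v Sv; apply/eqP/negPn/negP => v0; by apply: nS; exists v.
Qed.

Lemma half_line_equivalent (R : realType) (lnq : R[i])
    (r r' : rep (Uqso3 lnq)) a d c delta a' d' c' delta' :
  half_line (rep_act r I1) (rep_act r I2) a d c delta ->
  half_line (rep_act r' I1) (rep_act r' I2) a' d' c' delta' ->
  equivalent r r' -> a 0 = a' 0 /\ delta = delta'.
Proof.
move=> M M' [f [/bij_inj f_inj fact]].
exact: (half_line_intertwiner M M' f_inj).
Qed.

(** * The representations of the quantum algebra *)

Section Concrete.
Variables (R : realType) (lnq : R[i]).
Local Notation C := R[i].
Local Notation q := (cexp lnq).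
Local Notation s := (qpow lnq (1 / 2)).
Local Notation H := {freeg int / C}.
Local Notation c := (1 / (q - q^-1)).
Hypothesis q_free : forall n : nat, (0 < n)%N -> q ^+ n != 1.

Lemma q_neq0 : q != 0.
Proof. exact: cexp_neq0. Qed.

Lemma q_sub_neq0 : q - q^-1 != 0.
Proof.
apply: contra (q_free (isT : (0 < 2)%N)) => /eqP q2.
apply/eqP; transitivity (q * (q - q^-1) + 1); last by rewrite q2; ring.
by field; apply: q_neq0.
Qed.

Lemma step_neq0 : c != 0.
Proof. by rewrite mul1r invr_eq0 q_sub_neq0. Qed.

Lemma ket_coeff (m n : int) : coeff m (ket R n) = (n == m)%:R.
Proof. by rewrite coeffU mul1r. Qed.

(** The kets are eigenvectors of [I_1], hence go to multiples of basis vectors,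
at pairwise distinct sites by injectivity. Consider the ket which goes to the
lowest site [n]: its two neighbours go to distinct sites above [n], although
[I_2] reaches only [n+1] from [n] upwards. *)
Lemma Q_not_equivalent_half_line (lam : C) (adm : admissible lnq lam) (b : bool)
    (r : rep (Uqso3 lnq)) a d k delta :
  half_line (rep_act r I1) (rep_act r I2) a d k delta ->
  ~ equivalent (Q b adm) r.
Proof.
move=> M [f [/bij_inj f_inj fact]].
have fZ x v : f (x *: v) = x *: f v by apply: linearZ.
pose P n := `[< exists m k, k != 0 /\ f (ket R m) = k *: hl_vec M n >].
have eigP m : exists n k, k != 0 /\ f (ket R m) = k *: hl_vec M n.
  have [||n [k' [k0 E _]]] := @hl_eigenvector _ _ _ _ _ _ _ _ M
    ((-1) ^+ b * ((lam * q ^ m + lam^-1 * q ^ (- m)) / (q - q^-1)))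
    (f (ket R m)).
  - by rewrite -fact Q_actI1 Q_I1E linearZ.
  - rewrite -(linear0 f) (inj_eq f_inj); apply/eqP => /(congr1 (coeff m)).
    by rewrite ket_coeff eqxx coeff0 => /eqP; rewrite oner_eq0.
  - by exists n, k'.
have exP : exists n, P n.
  by have [n [k' E]] := eigP 0; exists n; apply/asboolP; exists 0, k'.
have [n /asboolP[m [k0 [k0_neq0 E0]]] n_min] := ex_minnP exP.
(* Distinct kets cannot share an eigenline of the target. *)
have distinct i j p k1 k2 : i != j -> k2 != 0 ->
    f (ket R i) = k1 *: hl_vec M p -> f (ket R j) = k2 *: hl_vec M p -> False.
  move=> ij k20 Ei Ej.
  have : f (k2 *: ket R i) = f (k1 *: ket R j).
    by rewrite !fZ Ei Ej !scalerA mulrC.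
  move=> /f_inj/(congr1 (coeff i)); rewrite !coeffZ !ket_coeff eqxx.
  by rewrite eq_sym (negPf ij) mulr0 mulr1 => /eqP; rewrite (negPf k20).
have [p [k1 [k1_neq0 E1]]] := eigP (m + 1).
have [t [k2 [k2_neq0 E2]]] := eigP (m - 1).
have np : (n < p)%N.
  rewrite ltn_neqAle n_min ?andbT; last by apply/asboolP; exists (m + 1), k1.
  apply/eqP => Enp; rewrite -Enp in E1.
  by apply: (distinct _ _ _ _ _ _ k0_neq0 E1 E0); apply/eqP; lia.
have nt : (n < t)%N.
  rewrite ltn_neqAle n_min ?andbT; last by apply/asboolP; exists (m - 1), k2.
  apply/eqP => Ent; rewrite -Ent in E2.
  by apply: (distinct _ _ _ _ _ _ k0_neq0 E2 E0); apply/eqP; lia.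
have pt : (p == t) = false.
  apply/eqP => Ept; rewrite Ept in E1.
  by apply: (distinct _ _ _ _ _ _ k2_neq0 E1 E2); apply/eqP; lia.
have := fact I2 (ket R m).
rewrite Q_actI2 Q_I2E linearD !fZ /= E0 E1 E2 => EJ.
(* I_2 climbs by at most one site, here from the site n of the image. *)
have J2_high l : (n.+1 < l)%N ->
    hl_coord M l (rep_act r I2 (k0 *: hl_vec M n)) = 0.
  move=> nl; rewrite linearZ hl_coordZ.
  case: {E0 n_min np nt EJ} n nl => [|n] nl.
    by rewrite (hl_J2_0 M) !hl_coordE !ltn_eqF ?(ltnW nl) // !mulr0 addr0 mulr0.
  have [h1 h2] : (n.+2 == l) = false /\ (n == l) = false by split; lia.
  by rewrite (hl_J2_S M) !hl_coordE h1 h2 !mulr0 addr0 mulr0.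
have up l kl : kl != 0 -> (n < l)%N ->
  hl_coord M l (rep_act r I2 (k0 *: hl_vec M n)) = c * kl -> l = n.+1.
  move=> kl0 nl El; apply/eqP; rewrite eqn_leq nl andbT leqNgt.
  apply/negP => /J2_high; rewrite El => /eqP.
  by rewrite mulf_eq0 (negPf step_neq0) (negPf kl0).
have Ep : p = n.+1.
  apply: (up _ k1) => //; rewrite -EJ !hl_coordE eqxx [t == p]eq_sym pt.
  by rewrite !mulr0 addr0 mulr1.
have Et : t = n.+1.
  apply: (up _ k2) => //; rewrite -EJ !hl_coordE eqxx pt.
  by rewrite !mulr0 add0r mulr1.
by rewrite Ep Et eqxx in pt.
Qed.

Definition weight (b : bool) (lam : C) (m : int) : C :=
  (-1) ^+ b * ((lam * q ^ m + lam^-1 * q ^ (- m)) / (q - q^-1)).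

(** With [x = lam q^i] and [y = lam q^j], equality of [x + x^-1] and [y + y^-1]
means [(x - y) (x y - 1) = 0]. The second hypothesis makes [x y] a positive power
of [q] whenever the sites differ, so neither factor vanishes. *)
Lemma weight_inj b (lam : C) (i : nat -> int) : lam != 0 ->
  (forall m n : nat, m != n ->
     i m != i n /\
     exists2 k : nat, (0 < k)%N & lam ^+ 2 * q ^ (i m + i n) = q ^+ k) ->
  injective (fun n => weight b lam (i n)).
Proof.
move=> lam0 Hi m n; have [//|/Hi[imn [k k0 Ek]]] := eqVneq m n.
rewrite /weight => /(can_inj (signrMK b)).
move/(mulIf _); rewrite invr_eq0 => /(_ q_sub_neq0).
have q0 := q_neq0; rewrite -!invr_expz.
have xm := expfz_neq0 (i m) q0; have xn := expfz_neq0 (i n) q0.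
have D : q ^ (i m - i n) = q ^ i m / q ^ i n by rewrite expfzDr ?invr_expz.
move: Ek; rewrite expfzDr // => Ek E.
have : (q ^ i m - q ^ i n) * (lam ^+ 2 * (q ^ i m * q ^ i n) - 1) = 0.
  transitivity ((lam * q ^ i m + lam^-1 * (q ^ i m)^-1
    - (lam * q ^ i n + lam^-1 * (q ^ i n)^-1)) * (lam * q ^ i m * q ^ i n)).
    by field; rewrite ?xm ?xn ?lam0.
  by rewrite E subrr mul0r.
move/eqP; rewrite mulf_eq0 Ek !subr_eq0 (negPf (q_free k0)) orbF => /eqP Emn.
have {D} D : q ^ (i m - i n) = 1 by rewrite D Emn divff.
have : q ^+ `|(i m - i n)%R|%N = 1.
  by case: (i m - i n) D => l; rewrite ?NegzE -?invr_expz //= => /eqP;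
    rewrite invr_eq1 => /eqP.
move/eqP; rewrite (negPf (q_free _)) // absz_gt0 subr_eq0 //.
Qed.

Lemma span_space_ind (X : H -> Prop) (P : span_space X -> Prop) :
  (forall u (Xu : u \in Defs.span X), X u -> P (SpanSpace Xu)) -> P 0 ->
  (forall k u v, P u -> P v -> P (k *: u + v)) -> forall v, P v.
Proof.
move=> PX P0 PL [v vX]; case/asboolP: (vX) => t [Xt Ev].
elim: t v vX Xt Ev => [|p t IH] v vX Xt Ev.
  by have -> : SpanSpace vX = 0 by apply: val_inj; rewrite /= Ev big_nil.
have Xp : X p.2 by apply: Xt; rewrite mem_head.
have Xt' z : z \in t -> X z.2 by move=> zt; apply: Xt; rewrite inE zt orbT.
have tX : \sum_(z <- t) z.1 *: z.2 \in Defs.span X by apply/asboolP; exists t.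
have -> : SpanSpace vX = p.1 *: SpanSpace (mem_span Xp) + SpanSpace tX.
  by apply: val_inj; rewrite /= Ev big_cons.
by apply: PL; [apply: PX | apply: IH].
Qed.

(** Everything is checked on kets: [w n] is the n-th basis vector and [i n] a site
which occurs in [w n] only, so that the coefficient at [i n] is the n-th
coordinate. *)
Lemma subrep_half_line (b : bool) (lam : C) (adm : admissible lnq lam)
    (X : Q b adm -> Prop)
    (invX : forall a v,
       v \in Defs.span X -> rep_act (Q b adm) a v \in Defs.span X)
    (w : nat -> H) (i : nat -> int) (d : nat -> C) (delta : C) :
  (forall n, X (w n)) -> (forall v, X v -> exists n, v = w n) ->
  (forall m n, coeff (i m) (w n) = (n == m)%:R) ->
  (forall n, Q_I1 lnq b lam (w n) = weight b lam (i n) *: w n) ->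
  Q_I2 lnq (w 0) = c *: w 1 + delta *: w 0 ->
  (forall n, Q_I2 lnq (w n.+1) = c *: w n.+2 + d n *: w n) ->
  injective (fun n => weight b lam (i n)) -> (forall n, d n != 0) ->
  half_line (rep_act (subrep invX) I1) (rep_act (subrep invX) I2)
    (fun n => weight b lam (i n)) d c delta.
Proof.
move=> Xw wX coeffw J1w J2w0 J2wS a_inj d0.
pose e n : subrep invX := SpanSpace (mem_span (Xw n)).
pose x n (v : subrep invX) := coeff (i n) (span_val v).
apply: (@HalfLine _ _ _ _ _ _ _ _ e x) => //.
- by move=> n k u v; rewrite /x /= coeffD coeffZ.
- move=> P Pe; apply: span_space_ind => u Xu /[dup] /wX[n En] Xu'.
  have -> : SpanSpace Xu = e n by apply: val_inj.
  exact: Pe.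
- by move=> n; apply: val_inj; rewrite /= Q_actI1.
- by apply: val_inj; rewrite /= Q_actI2.
- by move=> n; apply: val_inj; rewrite /= Q_actI2.
- exact: step_neq0.
Qed.

(** * The eight subrepresentations as half-line pairs *)

Definition sub_lam (l : sub_label) : C :=
  match l with Sub_1_1 | Sub_1_2 => 1 | Sub_sqrt_1 | Sub_sqrt_2 => s end.

(** The antisymmetric combinations vanish at site 0, so those of [V2] start one
site higher. *)
Definition sub_shift (l : sub_label) : nat :=
  if l is Sub_1_2 then 1 else 0.

(** For [W1] and [W2] the ket next to [|0>] on the other side of the reflection
is [|-1>], so the site below [e_0] is identified with [- e_0] or [e_0]. *)
Definition sub_delta (l : sub_label) : C :=
  match l with Sub_1_1 | Sub_1_2 => 0 | Sub_sqrt_1 => - c | Sub_sqrt_2 => c end.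

(** In [V1], [I_2 (|1> + |-1>)] contains [|0>] twice, once from each ket. *)
Definition sub_down (l : sub_label) (n : nat) : C :=
  match l, n with Sub_1_1, 0%N => c + c | _, _ => c end.

Definition sub_weight (l : sub_label) (b : bool) (n : nat) : C :=
  weight b (sub_lam l) (Posz (n + sub_shift l)).

Lemma sub_weight_inj l b : injective (sub_weight l b).
Proof.
apply: (weight_inj (i := fun n => Posz (n + sub_shift l))) => [|m n mn].
  by case: l => /=; rewrite ?oner_eq0 ?qpow_neq0.
split; first by apply: contra mn => /eqP[/addIn ->].
exists (m + sub_shift l + (n + sub_shift l)
        + if l is (Sub_sqrt_1 | Sub_sqrt_2) then 1 else 0)%N.
  by move: mn; case: l => /=; lia.
rewrite -PoszD -exprnP [RHS]exprD mulrC; congr (_ * _).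
by case: l => /=; rewrite ?expr1n ?expr0 // -q_sqr expr1.
Qed.

Lemma sub_down_neq0 l n : sub_down l n != 0.
Proof.
have := step_neq0; case: l; case: n => //= c0.
by rewrite -mulr2n mulrn_eq0.
Qed.

Lemma ket_refl_coeff (m n k : int) (e : C) : m != k ->
  coeff m (ket R n + e *: ket R k) = (n == m)%:R.
Proof.
move=> mk; rewrite coeffD coeffZ !ket_coeff [k == m]eq_sym (negPf mk).
by rewrite mulr0 addr0.
Qed.

(** The reflections are [m -> - m] for [V1], [V2] and [m -> - m - 1] for [W1],
[W2]; coordinates are read off on the nonnegative side of the line. *)
Lemma Q_sub_half_line l b :
  half_line (rep_act (Q_sub lnq l b) I1) (rep_act (Q_sub lnq l b) I2)
    (sub_weight l b) (sub_down l) c (sub_delta l).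
Proof.
have inj := @sub_weight_inj l b; have down0 := sub_down_neq0 l.
case: l inj down0 => inj down0.
- pose w (n : nat) : H :=
    if n is 0%N then ket R 0 else ket R n%:Z + ket R (- n%:Z).
  apply: (subrep_half_line _ (w := w)) => //.
  + case=> [|n]; [by left | by right; exists n.+1%:Z].
  + move=> v [->|[m [m1 ->]]]; first by exists 0%N.
    by exists `|m|%N; case: m m1 => // -[].
  + move=> m [|n]; first by rewrite ket_coeff /= addn0.
    rewrite /= -[ket R (- _)]scale1r ket_refl_coeff; last by apply/eqP; lia.
    by rewrite addn0.
  + case=> [|n]; first by rewrite Q_I1E /weight.
    have [E1 E2] := Q_I1_opp lnq b n.+1.
    by rewrite /w linearD E1 E2 -scalerDr /weight addn0.
  + by rewrite /w Q_I2E -scalerDr scale0r addr0.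
  + move=> n; rewrite /w linearD !Q_I2E.
    have -> : n.+1%:Z + 1 = n.+2%:Z by lia.
    have -> : n.+1%:Z - 1 = n%:Z by lia.
    have -> : - n.+1%:Z + 1 = - n%:Z by lia.
    have -> : - n.+1%:Z - 1 = - n.+2%:Z by lia.
    rewrite /sub_down; case: n => [|n]; apply: ket_comb_eq => j.
      by rewrite oppr0 !(coeffD, coeffZ); ring.
    by rewrite !(coeffD, coeffZ); ring.
- pose w (n : nat) : H := ket R n.+1%:Z - ket R (- n.+1%:Z).
  apply: (subrep_half_line _ (w := w)) => //.
  + by move=> n; exists n.+1%:Z.
  + by move=> v [m [m1 ->]]; exists (`|m|.-1)%N; case: m m1 => // -[].
  + move=> m n; rewrite /w -scaleN1r ket_refl_coeff; last by apply/eqP; lia.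
    by rewrite addn1.
  + move=> n; have [E1 E2] := Q_I1_opp lnq b n.+1.
    by rewrite /w linearB E1 E2 -scalerBr /weight addn1.
  + rewrite /w linearB !Q_I2E.
    have -> : 1%:Z + 1 = 2%:Z by [].
    have -> : 1%:Z - 1 = 0 by [].
    have -> : - 1%:Z + 1 = 0 by [].
    have -> : - 1%:Z - 1 = - 2%:Z by [].
    apply: ket_comb_eq => j.
    by rewrite scale0r addr0 !(coeffD, coeffN, coeffZ); ring.
  + move=> n; rewrite /w linearB !Q_I2E.
    have -> : n.+2%:Z + 1 = n.+3%:Z by lia.
    have -> : n.+2%:Z - 1 = n.+1%:Z by lia.
    have -> : - n.+2%:Z + 1 = - n.+1%:Z by lia.
    have -> : - n.+2%:Z - 1 = - n.+3%:Z by lia.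
    by apply: ket_comb_eq => j; rewrite !(coeffD, coeffN, coeffZ) /=; ring.
- pose w (n : nat) : H := ket R n%:Z - ket R (- n%:Z - 1).
  apply: (subrep_half_line _ (w := w)) => //.
  + by move=> n; exists n%:Z.
  + by move=> v [m [m1 ->]]; exists (`|m|)%N; case: m m1.
  + move=> m n; rewrite /w -scaleN1r ket_refl_coeff; last by apply/eqP; lia.
    by rewrite addn0.
  + move=> n; have [E1 E2] := Q_I1_refl lnq b n.
    by rewrite /w linearB E1 E2 -scalerBr /weight addn0.
  + rewrite /w linearB !Q_I2E.
    rewrite oppr0 !sub0r add0r addNr -opprD.
    by apply: ket_comb_eq => j; rewrite !(coeffD, coeffN, coeffZ) /=; ring.
  + move=> n; rewrite /w linearB !Q_I2E.
    have -> : n.+1%:Z + 1 = n.+2%:Z by lia.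
    have -> : n.+1%:Z - 1 = n%:Z by lia.
    have -> : - n.+1%:Z - 1 + 1 = - n%:Z - 1 by lia.
    have -> : - n.+1%:Z - 1 - 1 = - n.+2%:Z - 1 by lia.
    by apply: ket_comb_eq => j; rewrite !(coeffD, coeffN, coeffZ) /=; ring.
- pose w (n : nat) : H := ket R n%:Z + ket R (- n%:Z - 1).
  apply: (subrep_half_line _ (w := w)) => //.
  + by move=> n; exists n%:Z.
  + by move=> v [m [m1 ->]]; exists (`|m|)%N; case: m m1.
  + move=> m n; rewrite /w -[ket R (- _ - _)]scale1r ket_refl_coeff.
      by rewrite addn0.
    by apply/eqP; lia.
  + move=> n; have [E1 E2] := Q_I1_refl lnq b n.
    by rewrite /w linearD E1 E2 -scalerDr /weight addn0.
  + rewrite /w linearD !Q_I2E.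
    rewrite oppr0 !sub0r add0r addNr -opprD.
    by apply: ket_comb_eq => j; rewrite !(coeffD, coeffZ) /=; ring.
  + move=> n; rewrite /w linearD !Q_I2E.
    have -> : n.+1%:Z + 1 = n.+2%:Z by lia.
    have -> : n.+1%:Z - 1 = n%:Z by lia.
    have -> : - n.+1%:Z - 1 + 1 = - n%:Z - 1 by lia.
    have -> : - n.+1%:Z - 1 - 1 = - n.+2%:Z - 1 by lia.
    by apply: ket_comb_eq => j; rewrite !(coeffD, coeffZ) /=; ring.
Qed.

Lemma sub_weight0 l b :
  let y := match l with Sub_1_1 => 1 | Sub_1_2 => q | _ => s end in
  sub_weight l b 0 = (-1) ^+ b * ((y + y^-1) / (q - q^-1)).
Proof.
by case: l; rewrite /sub_weight /weight /= ?expr0z ?expr1z ?invr1 ?mulr1 ?mul1r.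
Qed.

Lemma sub_weight0_neq0 l b : sub_weight l b 0 != 0.
Proof.
rewrite sub_weight0 mulf_neq0 ?signr_eq0 // mulf_neq0 ?invr_eq0 ?q_sub_neq0 //.
have sumV_neq0 (y : C) : y != 0 -> y ^+ 4 != 1 -> y + y^-1 != 0.
  move=> y0; apply: contra => /eqP yV; rewrite -subr_eq0.
  have -> : y ^+ 4 - 1 = (y ^+ 2 - 1) * y * (y + y^-1) by field.
  by rewrite yV mulr0.
have s4 : s ^+ 4 = q ^+ 2 by rewrite q_sqr -exprM.
case: l; first by rewrite invr1 -mulr2n pnatr_eq0.
all: by apply: sumV_neq0; rewrite ?cexp_neq0 ?qpow_neq0 ?s4 ?q_free.
Qed.

(** Up to sign and a common factor the two eigenvalues are [2] and [q + q^-1],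
and [(q + q^-1)^2 - 2^2 = (q - q^-1)^2]. *)
Lemma sub_weight0_neq b b' :
  sub_weight Sub_1_1 b 0 != sub_weight Sub_1_2 b' 0.
Proof.
apply/eqP => /(congr1 (fun z => z ^+ 2)).
rewrite !sub_weight0 !exprMn !sqrr_sign !mul1r invr1.
move/(mulIf _); rewrite expf_neq0 ?invr_eq0 ?q_sub_neq0 // => /(_ isT) E.
have : (q - q^-1) ^+ 2 = 0.
  transitivity ((q + q^-1) ^+ 2 - (1 + 1) ^+ 2); last by rewrite E subrr.
  by field; apply: q_neq0.
by move/eqP; rewrite expf_eq0 (negPf q_sub_neq0).
Qed.

Lemma sub_lowest_inj l l' b b' :
  sub_weight l b 0 = sub_weight l' b' 0 -> sub_delta l = sub_delta l' ->
  (l, b) = (l', b').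
Proof.
have sign_inj k : sub_weight k b 0 = sub_weight k b' 0 -> b = b'.
  have := sub_weight0_neq0 k false; rewrite !sub_weight0 expr0 mul1r => z0.
  by move/(mulIf z0)/eqP; rewrite (inj_eq (@signr_inj _)) => /eqP.
have c0 := negPf step_neq0.
have cN0 : (- c == 0) = false by rewrite oppr_eq0.
have cNc : (- c == c) = false by rewrite eqNr.
case: l l' => [] [] Ew; try by rewrite (sign_inj _ Ew).
1: by have := sub_weight0_neq b b'; rewrite Ew eqxx.
3: by have := sub_weight0_neq b' b; rewrite -Ew eqxx.
all: by move/eqP; rewrite /sub_delta ?(eq_sym 0) ?(eq_sym c (- c)) ?c0 ?cN0 ?cNc.
Qed.

End Concrete.

Theorem theorem3 (R : realType) (q lnq : R[i])
    (q_neq0 : q != 0) (q_log : cexp lnq = q)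
    (q_not_root : forall n : nat, (0 < n)%N -> ~~ n.-unity_root q) :
  (forall (l : sub_label) (b : bool), irreducible (Q_sub lnq l b)) /\
  (forall (l l' : sub_label) (b b' : bool), (l, b) <> (l', b') ->
     ~ equivalent (Q_sub lnq l b) (Q_sub lnq l' b')) /\
  (forall (lam : R[i]) (adm : admissible lnq lam) (b : bool)
          (l : sub_label) (b' : bool),
     ~ equivalent (Q b adm) (Q_sub lnq l b')).
Proof.
have q_free n : (0 < n)%N -> cexp lnq ^+ n != 1.
  by move=> n0; rewrite q_log -unity_rootE q_not_root.
have model := @Q_sub_half_line R lnq q_free.
split; [|split].
- by move=> l b; apply: half_line_irreducible (model l b).
- move=> l l' b b' ne eqv; apply: ne.
  have [Ew Ed] := half_line_equivalent (model l b) (model l' b') eqv.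
  exact: (sub_lowest_inj q_free Ew Ed).
- move=> lam adm b l b'.
  exact: (Q_not_equivalent_half_line q_free (model l b')).
Qed.
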